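(* Let $d>0$, $d\in\mathbb{Q}$, $\sqrt d\notin\mathbb{Q}$. Let $A$ be a trapezoid of height $1$ with both angles at its larger base equal to $45^\circ$ and with midline of length $a\in\mathbb{Q}[\sqrt d]$, where $1<\overline a<a$. Then there exist infinitely many distinct $b\in\mathbb{Q}[\sqrt d]$ such that both of the following hold: (1) $\ln G(b)/\ln\overline{G(b)}=\ln G(a)/\ln\overline{G(a)}$, where $G(x)=(x-1)/(x+1)$; (2) a trapezoid of height $1$ with bases parallel to those of $A$, both angles at the larger base equal to $45^\circ$, and midline of length $b$ can be trivially tiled by trapezoids homothetic to $A$.
   Context: $\mathbb{Q}[\sqrt d]$ is the set of real numbers $u+v\sqrt d$ with $u,v\in\mathbb{Q}$; for $x=u+v\sqrt d$ with $u,v\in\mathbb{Q}$, the conjugate is $\overline x=u-v\sqrt d$ (so $\overline{G(x)}=G(\overline x)$). A trapezoid is a quadrilateral with exactly one pair of parallel sides; these are its bases, and its midline has length equal to half the sum of the lengths of the bases. A figure is homothetic to $A$ if it is its image under a map $z\mapsto \lambda z+w$ of the plane with real $\lambda\neq 0$ (negative $\lambda$ allowed) and $w\in\mathbb{R}^2$. A tiling of a figure is a representation of it as a finite union of figures (tiles) with pairwise disjoint interiors. Trivial tilings are defined recursively: a tiling of a plane figure is trivial if either (1) it consists of the figure itself only, or (2) there is a segment that runs only along boundaries of tiles and divides the figure into two figures, each of which is trivially tiled (by the tiles it contains). *)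

(* Defs.v *)
(* Written over MathComp-Analysis: the plane is R * R for R : realType, with
   its product topology and its structure of a vector space over R. *)
From HB Require Import structures.
From mathcomp Require Import all_boot all_order all_algebra.
From mathcomp Require Import all_classical all_reals all_analysis.

Set Implicit Arguments.
Unset Strict Implicit.
Unset Printing Implicit Defensive.

Import Order.TTheory GRing.Theory Num.Theory.
Import numFieldNormedType.Exports.

Local Open Scope classical_set_scope.
Local Open Scope ring_scope.

Section QuadraticNumbers.
Context {R : realType}.
Implicit Types (d : rat) (x y : R).

Definition Qsqrt d : set R :=
  [set x | exists u v : rat, x = ratr u + ratr v * Num.sqrt (ratr d)].

(* When sqrt d is irrational the coefficients u, v of an x in Q[sqrt d] are
   unique, hence so is the y chosen below; outside Q[sqrt d] the value is
   unspecified. *)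
Definition conjQ d x : R :=
  get [set y | exists u v : rat,
    x = ratr u + ratr v * Num.sqrt (ratr d) /\
    y = ratr u - ratr v * Num.sqrt (ratr d)].

Definition G x : R := (x - 1) / (x + 1).

End QuadraticNumbers.

Section PlaneGeometry.
Context {R : realType}.
Local Notation plane := (R * R)%type.
Implicit Types (p q r s v w z : plane) (F A : set plane).

Definition dot v w : R := v.1 * w.1 + v.2 * w.2.

(* The Euclidean length; the library norm on R * R is the max norm. *)
Definition elength v : R := Num.sqrt (dot v v).

Definition parallel v w : Prop := v.1 * w.2 = v.2 * w.1.

Definition collinear p q r : Prop := parallel (q - p) (r - p).

(* The angle at the vertex q, in radians. *)
Definition angle p q r : R :=
  acos (dot (p - q) (r - q) / (elength (p - q) * elength (r - q))).

Definition segment p q : set plane :=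
  [set z | exists t : R, 0 <= t <= 1 /\ z = (1 - t) *: p + t *: q].

Definition line p q : set plane :=
  [set z | exists t : R, z = (1 - t) *: p + t *: q].

(* h is the length of the perpendicular dropped from r to the line p q. *)
Definition line_distance p q r (h : R) : Prop :=
  exists f, [/\ line p q f, dot (r - f) (q - p) = 0 & elength (r - f) = h].

Definition hull4 p q r s : set plane :=
  [set z | exists a b c e : R,
    [/\ [/\ 0 <= a, 0 <= b, 0 <= c & 0 <= e],
        a + b + c + e = 1
      & z = a *: p + b *: q + c *: r + e *: s]].

(* F is the closed region of the convex quadrilateral with vertices p, q, r, s
   in cyclic order: no three vertices are collinear and the diagonals p r and
   q s meet.  A simple quadrilateral with two parallel sides is convex, so for
   trapezoids convexity is no restriction. *)
Definition convex_quadrilateral F p q r s : Prop :=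
  [/\ [/\ ~ collinear p q r, ~ collinear q r s,
          ~ collinear r s p & ~ collinear s p q],
      segment p r `&` segment q s !=set0
    & F = hull4 p q r s].

(* The bases are p q and r s, the legs are q r and s p. *)
Definition trapezoid F p q r s : Prop :=
  [/\ convex_quadrilateral F p q r s,
      parallel (q - p) (s - r)
    & ~ parallel (r - q) (p - s)].

(* Height 1, midline m, larger base p q. *)
Definition trapezoid45 (m : R) F p q r s : Prop :=
  [/\ trapezoid F p q r s,
      elength (s - r) < elength (q - p),
      line_distance p q r 1,
      angle s p q = pi / 4 /\ angle p q r = pi / 4
    & (elength (q - p) + elength (s - r)) / 2 = m].

Definition homothetic A F : Prop :=
  exists (l : R) (w : plane), l != 0 /\ F = [set l *: z + w | z in A].

End PlaneGeometry.

Section Tilings.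
Context {R : realType}.
Local Notation plane := (R * R)%type.
Implicit Types (F S : set plane) (T : set (set plane)).

Definition boundary F : set plane := closure F `\` interior F.

Definition tiling F T : Prop :=
  [/\ finite_set T, \bigcup_(t in T) t = F & trivIset T interior].

(* F minus S is the disjoint union of two nonempty relatively closed parts, and
   F1, F2 are these parts together with S. *)
Definition divides S F F1 F2 : Prop :=
  [/\ closed F1 /\ closed F2,
      F1 `|` F2 = F,
      F1 `&` F2 = S
    & F1 `\` S !=set0 /\ F2 `\` S !=set0].

Inductive trivial_tiling : set plane -> set (set plane) -> Prop :=
| trivial_self F : trivial_tiling F [set F]
| trivial_cut F T (p q : plane) F1 F2 :
    tiling F T ->
    p != q ->
    segment p q `<=` \bigcup_(t in T) boundary t ->
    divides (segment p q) F F1 F2 ->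
    trivial_tiling F1 [set t | T t /\ t `<=` F1] ->
    trivial_tiling F2 [set t | T t /\ t `<=` F2] ->
    trivial_tiling F T.

Definition trivially_tiled_by_homothets F (A : set plane) : Prop :=
  exists T, [/\ tiling F T, trivial_tiling F T
              & forall t, T t -> homothetic A t].

End Tilings.

(* Main.v *)
Require Import Defs.
From HB Require Import structures.
From mathcomp Require Import all_boot all_order all_algebra.
From mathcomp Require Import all_classical all_reals all_analysis.
From mathcomp Require Import ring lra zify.

Set Implicit Arguments.
Unset Strict Implicit.
Unset Printing Implicit Defensive.

Import Order.TTheory GRing.Theory Num.Theory.
Import numFieldNormedType.Exports.

Local Open Scope classical_set_scope.
Local Open Scope ring_scope.

(** For a trapezoid of height 1, midline [x] and 45 degree angles at the larger
    base, the bases are [x + 1] and [x - 1], so [G x] is the ratio of the smaller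
    base to the larger one.  Put [g = G a].  Pile up [k] copies of [A], each
    turned the same way and shrunk by the factor [g] with respect to the one
    below, so that its larger base is the smaller base of that one.  The legs
    line up, and the pile is again a 45 degree trapezoid, whose bases have ratio
    [g ^+ k].  Rescaled to height 1 it has midline [b] with [G b = g ^+ k], that
    is, [b = (1 + g ^+ k) / (1 - g ^+ k)], which lies in Q[sqrt d].  Cutting along
    the common bases one after the other shows that the tiling is trivial
    ([trivially_tiled_power]).

    Conjugation is a field automorphism, so the conjugate of [G b] is the [k]-th
    power of the conjugate of [G a].  Both logarithms are multiplied by [k] and
    their quotient does not change.  Distinct [k] give distinct [b] because
    [0 < g < 1].

    The geometry is done in an orthonormal frame.  The hypotheses on lengths and
    angles determine the four vertices in a frame attached to the larger base
    ([trapezoid45_band]), so every trapezoid of the required kind is a [band],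
    described by linear inequalities on the two coordinates.  In the same terms
    all layers of the pile are bands of a single triangle, cut at the heights
    where its width is [g ^+ i] times the base. *)

(** * Conjugation in Q[sqrt d] *)

Section Conjugation.
Context {R : realType} (d : rat).
Implicit Types x y : R.

(** Conjugation as a relation makes its compatibility with the field operations
    a computation on the coefficients.  When [sqrt d] is irrational, [conjQ d x]
    is the only conjugate of an [x] in Q[sqrt d]. *)
Definition conjugates x y : Prop := exists u v : rat,
  x = ratr u + ratr v * Num.sqrt (ratr d) /\
  y = ratr u - ratr v * Num.sqrt (ratr d).

Lemma conjugates_rat (c : rat) : conjugates (ratr c) (ratr c).
Proof. by exists c, 0; rewrite rmorph0 mul0r addr0 subr0. Qed.

Lemma conjugatesD x y x' y' :
  conjugates x y -> conjugates x' y' -> conjugates (x + x') (y + y').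
Proof.
move=> [u [v [-> ->]]] [u' [v' [-> ->]]]; exists (u + u'), (v + v').
by rewrite !rmorphD /=; split; ring.
Qed.

Lemma conjugatesN x y : conjugates x y -> conjugates (- x) (- y).
Proof.
move=> [u [v [-> ->]]]; exists (- u), (- v).
by rewrite !rmorphN /=; split; ring.
Qed.

Hypothesis hd : 0 < d.

Let sqr_sqrtd : Num.sqrt (ratr d : R) ^+ 2 = ratr d.
Proof. by rewrite sqr_sqrtr// ler0q ltW. Qed.

Lemma conjugatesM x y x' y' :
  conjugates x y -> conjugates x' y' -> conjugates (x * x') (y * y').
Proof.
move=> [u [v [-> ->]]] [u' [v' [-> ->]]].
exists (u * u' + v * v' * d), (u * v' + v * u').
have := sqr_sqrtd; set s := Num.sqrt _ => sE.
by rewrite !rmorphD !rmorphM /= -sE; split; ring.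
Qed.

Lemma conjugatesX x y n : conjugates x y -> conjugates (x ^+ n) (y ^+ n).
Proof.
move=> xy; elim: n => [|n IHn]; last by rewrite !exprS; exact: conjugatesM.
by rewrite !expr0 -(rmorph1 (@ratr R)); exact: conjugates_rat.
Qed.

(** [x^-1 = y / (x * y)], and the norm [x * y] is rational. *)
Lemma conjugatesV x y :
  x != 0 -> y != 0 -> conjugates x y -> conjugates x^-1 y^-1.
Proof.
move=> x0 y0 [u [v [xE yE]]].
have [N NE] : exists N : rat, ratr N = x * y.
  exists (u * u - d * (v * v)).
  have := sqr_sqrtd; rewrite xE yE; set s := Num.sqrt _ => sE.
  by rewrite rmorphB !rmorphM /= -sE; ring.
have N0 : x * y != 0 by rewrite mulf_neq0.
exists (u / N), (- v / N).
rewrite !rmorphM rmorphN fmorphV /= NE; split.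
- transitivity ((ratr u - ratr v * Num.sqrt (ratr d)) / (x * y)); last by ring.
  by rewrite -yE; field; rewrite x0 y0.
- transitivity ((ratr u + ratr v * Num.sqrt (ratr d)) / (x * y)); last by ring.
  by rewrite -xE; field; rewrite x0 y0.
Qed.

Lemma conjugates_G x y : x + 1 != 0 -> y + 1 != 0 ->
  conjugates x y -> conjugates (G x) (G y).
Proof.
move=> x0 y0 xy; have c1 : conjugates 1 1.
  by rewrite -(rmorph1 (@ratr R)); exact: conjugates_rat.
apply: conjugatesM; first by apply: conjugatesD => //; exact: conjugatesN.
by apply: conjugatesV => //; exact: conjugatesD.
Qed.

Lemma conjugates_Qsqrt x y : conjugates x y -> Qsqrt d x.
Proof. by move=> [u [v [-> _]]]; exists u, v. Qed.

Hypothesis hirr : irrational (Num.sqrt (ratr d) : R).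

(** Two different representations of [x] would give [sqrt d] as a quotient of
    rationals. *)
Lemma conjugates_unique x y y' : conjugates x y -> conjugates x y' -> y = y'.
Proof.
move=> [u [v [-> ->]]] [u' [v' [E ->]]].
have [vv'|vv'] := eqVneq v v'.
  by move: E; rewrite vv' => /addIr ->.
exfalso; apply: hirr; exists ((u - u') / (v' - v)) => //.
rewrite rmorphM fmorphV !rmorphB /=.
have nz : ratr v' - ratr v != 0 :> R.
  by rewrite -rmorphB fmorph_eq0 subr_eq0 eq_sym.
apply: (mulIf nz); rewrite divfK//.
have -> : ratr u = ratr u' + ratr v' * Num.sqrt (ratr d) -
  ratr v * Num.sqrt (ratr d) :> R by rewrite -E addrK.
ring.
Qed.

Lemma conjQE x y : conjugates x y -> conjQ d x = y.
Proof.
move=> xy; apply: (@conjugates_unique x) => //.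
have /(getPex) := ex_intro _ y xy; exact.
Qed.

Lemma conjugates_conjQ x : Qsqrt d x -> conjugates x (conjQ d x).
Proof.
move=> [u [v xE]].
have xy : conjugates x (ratr u - ratr v * Num.sqrt (ratr d)) by exists u, v.
by rewrite (conjQE xy).
Qed.

End Conjugation.

(** * Midline and ratio of the bases *)

Section PowerOfBaseRatio.
Context {R : realType}.
Implicit Types x g : R.

(** The inverse of the Moebius map [G]: the midline of the trapezoid of height 1
    with angles of 45 degrees at the larger base whose bases have ratio [g]. *)
Definition midline_of_ratio g : R := (1 + g) / (1 - g).

Lemma G_midline g : g != 1 -> G (midline_of_ratio g) = g.
Proof.
move=> g1; rewrite /G /midline_of_ratio; field.
have -> : 1 + g + (1 - g) = 2 by ring.
by rewrite subr_eq0 eq_sym g1 pnatr_eq0.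
Qed.

Lemma G_gt0_lt1 x : 1 < x -> 0 < G x < 1.
Proof.
move=> x1; rewrite /G divr_gt0/=; [|lra|lra].
by rewrite ltr_pdivrMr; lra.
Qed.

Lemma divr_mulrn x y n : (x *+ n.+1) / (y *+ n.+1) = x / y.
Proof.
rewrite -[x *+ _]mulr_natr -[y *+ _]mulr_natr; move: (n.+1%:R : R) (pnatr_eq0 R n.+1).
by move=> c /negbT c0; rewrite invfM mulrACA divff ?mulr1.
Qed.

Lemma exprn_gt0_lt1 g n : 0 < g < 1 -> 0 < g ^+ n.+1 < 1.
Proof. by move=> /andP[g0 g1]; rewrite exprn_gt0//= exprn_ilt1// ltW. Qed.

Lemma midline_gt1 g : 0 < g < 1 -> 1 < midline_of_ratio g.
Proof.
by move=> /andP[g0 g1]; rewrite /midline_of_ratio ltr_pdivlMr; lra.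
Qed.

End PowerOfBaseRatio.

(** * Orthonormal frames and bands of a triangle *)

Section Frames.
Context {R : realType}.
Local Notation plane := (R * R)%type.
Implicit Types (o e n z w : plane) (x y t W u v : R).

Definition orthonormal e n : Prop := [/\ dot e e = 1, dot n n = 1 & dot e n = 0].

Definition frame_point o e n x y : plane := o + x *: e + y *: n.

Lemma planeE (z w : plane) : z.1 = w.1 -> z.2 = w.2 -> z = w.
Proof. by case: z w => [? ?] [? ?] /= -> ->. Qed.

Lemma dotZ x y z w : dot (x *: z) (y *: w) = x * y * dot z w.
Proof. by rewrite /dot /= /GRing.scale /=; ring. Qed.

Lemma dot_frame_fst o e n x y :
  orthonormal e n -> dot (frame_point o e n x y - o) e = x.
Proof.
move=> [ee nn en]; transitivity (x * dot e e + y * dot e n).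
  by rewrite /dot /frame_point /= /GRing.scale /=; ring.
by rewrite ee en; ring.
Qed.

Lemma dot_frame_snd o e n x y :
  orthonormal e n -> dot (frame_point o e n x y - o) n = y.
Proof.
move=> [ee nn en]; transitivity (x * dot e n + y * dot n n).
  by rewrite /dot /frame_point /= /GRing.scale /=; ring.
by rewrite nn en; ring.
Qed.

(** In dimension 2 the second vector is [e] turned by a right angle, up to
    the sign [s]; this is why two orthonormal vectors span the plane. *)
Lemma orthonormal_rot e n : orthonormal e n ->
  exists s, s ^+ 2 = 1 /\ n = s *: (- e.2, e.1).
Proof.
case: e n => [a b] [c f]; rewrite /orthonormal /dot /= => -[ee nn en].
exists (a * f - b * c); split.
  transitivity ((a * a + b * b) * (c * c + f * f) - (a * c + b * f) ^+ 2).
    ring.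
  by rewrite ee nn en; ring.
apply: planeE; rewrite /= /GRing.scale /=.
- transitivity ((a * a + b * b) * c - (a * c + b * f) * a); last ring.
  by rewrite ee en; ring.
- transitivity ((a * a + b * b) * f - (a * c + b * f) * b); last ring.
  by rewrite ee en; ring.
Qed.

Lemma frame_pointE o e n z : orthonormal e n ->
  z = frame_point o e n (dot (z - o) e) (dot (z - o) n).
Proof.
move=> en; have [s [s1 nE]] := orthonormal_rot en.
case: en; rewrite nE {1}/dot => ee _ _.
rewrite /frame_point /dot /= /GRing.scale /=.
apply: planeE; rewrite /= /GRing.scale /=.
- transitivity (o.1 + ((z.1 - o.1) * (e.1 * e.1 + s ^+ 2 * (e.2 * e.2)) +
    (z.2 - o.2) * e.1 * e.2 * (1 - s ^+ 2))); last ring.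
  by rewrite s1 mul1r ee; ring.
- transitivity (o.2 + ((z.2 - o.2) * (e.2 * e.2 + s ^+ 2 * (e.1 * e.1)) +
    (z.1 - o.1) * e.1 * e.2 * (1 - s ^+ 2))); last ring.
  by rewrite s1 mul1r [e.2 * _ + _]addrC ee; ring.
Qed.

Lemma frame_point_inj o e n x y x' y' : orthonormal e n ->
  frame_point o e n x y = frame_point o e n x' y' -> x = x' /\ y = y'.
Proof.
move=> en E; split.
- by rewrite -(dot_frame_fst o x y en) E dot_frame_fst.
- by rewrite -(dot_frame_snd o x y en) E dot_frame_snd.
Qed.

Lemma continuous_dot o w : continuous (fun z : plane => dot (z - o) w : R^o).
Proof.
move=> z; apply: (@cvgD _ R^o); apply: (@cvgM R); try exact: cvg_cst.
- by apply: (@cvgB _ R^o); [exact: cvg_fst|exact: cvg_cst].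
- by apply: (@cvgB _ R^o); [exact: cvg_snd|exact: cvg_cst].
Qed.

Lemma closed_half_plane_le o w (c : R) : closed [set z | dot (z - o) w <= c].
Proof.
apply: (@preimage_closed _ R^o (fun z => dot (z - o) w) [set x | x <= c]).
- by move=> z _; exact: continuous_dot.
- exact: closed_le.
Qed.

Lemma closed_half_plane_ge o w (c : R) : closed [set z | c <= dot (z - o) w].
Proof.
apply: (@preimage_closed _ R^o (fun z => dot (z - o) w) [set x | c <= x]).
- by move=> z _; exact: continuous_dot.
- exact: closed_ge.
Qed.

(** The part between the heights [u] and [v] of the triangle that stands on
    the base of length [W] starting at [o], with base angles of 45 degrees: [n]
    points upwards and the apex is at height [W / 2].  For [u < v < W / 2] it is
    a trapezoid. *)
Definition band o e n W u v : set plane :=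
  [set z | u <= dot (z - o) n <= v /\
           dot (z - o) n <= dot (z - o) e <= W - dot (z - o) n].

End Frames.

(** * Tilings of a band by thinner bands *)

Section Bands.
Context {R : realType}.
Local Notation plane := (R * R)%type.
Variables (o e n : plane) (W : R).
Hypothesis en : orthonormal e n.
Local Notation pt := (frame_point o e n).
Local Notation band := (band o e n W).

Lemma band_pt u v x y :
  band u v (pt x y) <-> u <= y <= v /\ y <= x <= W - y.
Proof. by rewrite /band /= dot_frame_fst// dot_frame_snd. Qed.

Lemma bandP u v z : band u v z <->
  exists x y, [/\ z = pt x y, u <= y <= v & y <= x <= W - y].
Proof.
split=> [[uv xy]|[x [y [-> uv xy]]]]; last exact/band_pt.
exists (dot (z - o) e), (dot (z - o) n); split=> //; exact: frame_pointE.
Qed.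

Lemma closed_band u v : closed (band u v).
Proof.
have -> : band u v = [set z | u <= dot (z - o) n] `&` [set z | dot (z - o) n <= v]
  `&` ([set z | 0 <= dot (z - o) (e - n)] `&` [set z | dot (z - o) (e + n) <= W]).
  apply/seteqP; split=> z; rewrite /band /dot /=.
    by move=> [/andP[-> ->] /andP[]] ? ?; split=> //; split; lra.
  by move=> [[-> ->] [? ?]]; split=> //; apply/andP; split; lra.
by apply: closedI; apply: closedI;
  (exact: closed_half_plane_le || exact: closed_half_plane_ge).
Qed.

(** A point of an open set can be moved a little along [n] both ways. *)
Lemma interior_band u v z : (band u v)° z -> u < dot (z - o) n < v.
Proof.
case: (bandP u v z) => + _ => /[swap] zi /(_ (interior_subset zi))[x [y [zE _ _]]].
have cvgz : (fun t : R => pt x (y + t)) @ (0 : R) --> z.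
  rewrite zE; apply: cvgD; first exact: cvg_cst.
  apply: cvgZ; last exact: cvg_cst.
  suff : (fun t : R => y + t) @ (0 : R) --> (y + 0 : R) by rewrite addr0.
  by apply: (@cvgD _ R^o); [exact: cvg_cst|exact: cvg_id].
have /cvgz /nbhs_ballP[r /= r0 rB] := zi.
have rin t : `|t| < r -> u <= y + t <= v.
  by move=> tr; have /band_pt[] : band u v (pt x (y + t)) by
    apply: rB; rewrite /ball /= sub0r normrN.
rewrite zE dot_frame_snd//; apply/andP; split.
- have /rin : `|- (r / 2)| < r by rewrite normrN gtr0_norm; lra.
  lra.
- have /rin : `|r / 2| < r by rewrite gtr0_norm; lra.
  lra.
Qed.

(** The lowest and the highest points on one leg already determine the heights. *)
Lemma subset_band u v u' v' : u <= v -> v <= W / 2 ->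
  band u v `<=` band u' v' -> u' <= u /\ v <= v'.
Proof.
move=> uv vW S; split.
- have /S /band_pt[] : band u v (pt u u) by apply/band_pt; lra.
  lra.
- have /S /band_pt[] : band u v (pt v v) by apply/band_pt; lra.
  lra.
Qed.

Lemma band_subset u v u' v' :
  u' <= u -> v <= v' -> band u v `<=` band u' v'.
Proof. by move=> ? ? z [/andP[? ?] ?]; split=> //; lra. Qed.

Lemma boundary_band_top u v x :
  u <= v -> v <= x <= W - v -> boundary (band u v) (pt x v).
Proof.
move=> uv xv; split; first by apply: subset_closure; apply/band_pt; lra.
by move=> /interior_band; rewrite dot_frame_snd// ltxx andbF.
Qed.

Lemma segment_level y z : y < W / 2 ->
  segment (pt y y) (pt (W - y) y) z <->
  exists x, z = pt x y /\ y <= x <= W - y.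
Proof.
move=> yW; split=> [[t [t01 ->]]|[x [-> xy]]].
- exists (y + t * (W - y *+ 2)); split.
    by apply: planeE; rewrite /frame_point /= /GRing.scale /=; ring.
  have W2 : 0 < W - y *+ 2 by lra.
  by apply/andP; split; nra.
- have W2 : 0 < W - y *+ 2 by lra.
  exists ((x - y) / (W - y *+ 2)); split.
    apply/andP; split; first by rewrite divr_ge0//; lra.
    by rewrite ler_pdivrMr//; lra.
  by apply: planeE; rewrite /frame_point /= /GRing.scale /=; field; lra.
Qed.

Lemma divides_band u y v : u < y -> y < v -> v < W / 2 ->
  divides (segment (pt y y) (pt (W - y) y))
    (band u v) (band u y) (band y v).
Proof.
move=> uy yv vW.
have yW : y < W / 2 by lra.
split; first by split; exact: closed_band.
- apply/seteqP; split=> z.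
    by move=> [|]; apply: band_subset; lra.
  move=> [/andP[? ?] ?].
  by case: (leP (dot (z - o) n) y) => ?; [left|right]; split=> //; lra.
- apply/seteqP; split=> z.
    move=> [[/andP[_ zy] _] [/andP[yz _] zx]]; apply/segment_level => //.
    exists (dot (z - o) e).
    have -> : y = dot (z - o) n by apply/eqP; rewrite eq_le yz zy.
    by split=> //; exact: frame_pointE.
  by move=> /(segment_level _ yW)[x [-> xy]]; split; apply/band_pt; lra.
- split; [exists (pt u u)|exists (pt v v)]; split;
    try (by apply/band_pt; lra);
    move=> /(segment_level _ yW)[x [/(frame_point_inj en)[_ E] _]]; lra.
Qed.

Section Stack.
Variables (h : nat -> R).
Hypothesis h_incr : forall i, h i < h i.+1.
Hypothesis h_small : forall i, h i < W / 2.

Definition layers (m k : nat) : set (set plane) :=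
  [set band (h i) (h i.+1) | i in [set i | (m <= i < k)%N]].

Let h_lt i j : (h i < h j) = (i < j)%N.
Proof. by have /leW_mono := (increasing_seqP h).1 h_incr; apply. Qed.

Let h_le i j : (h i <= h j) = (i <= j)%N.
Proof. exact: (increasing_seqP h).1. Qed.

Lemma layers1 m : layers m m.+1 = [set band (h m) (h m.+1)].
Proof.
apply/seteqP; split=> [t [i /= mi <-]|t ->]; last by exists m => //=; lia.
by have -> : i = m by lia.
Qed.

Lemma layers_sub m k m' k' : (m <= m')%N -> (k' <= k)%N ->
  [set t | layers m k t /\ t `<=` band (h m') (h k')] = layers m' k'.
Proof.
move=> mm' kk'; apply/seteqP; split=> [t [[i /= mik <-]] S|t [i /= mik <-]].
  have [] := subset_band (ltW (h_incr i)) (ltW (h_small i.+1)) S.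
  by rewrite !h_le => mi ik; exists i => //=; lia.
split; first by exists i => //=; lia.
by apply: band_subset; rewrite h_le; lia.
Qed.

Lemma bigcup_layers m k :
  \bigcup_(t in layers m (m + k.+1)%N) t = band (h m) (h (m + k.+1)%N).
Proof.
apply/seteqP; split=> [z [t [i /= mik <-]]|].
  by apply: band_subset; rewrite h_le; lia.
elim: k => [|k IHk] z zb.
  by exists (band (h m) (h (m + 1)%N)) => //; rewrite addn1 layers1.
case: zb => /andP[mz zk] zx.
case: (leP (dot (z - o) n) (h (m + k.+1)%N)) => zk'.
  have [|t [i /= mik <-] zi] := IHk z; first by split=> //; rewrite mz.
  by exists (band (h i) (h i.+1)) => //; exists i => //=; lia.
exists (band (h (m + k.+1)%N) (h (m + k.+1).+1)).
  by exists (m + k.+1)%N => //=; lia.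
by split=> //; rewrite ltW//= -addnS.
Qed.

Lemma tiling_layers m k :
  tiling (band (h m) (h (m + k.+1)%N)) (layers m (m + k.+1)%N).
Proof.
split; last 1 first.
- move=> _ _ [i _ <-] [j _ <-] [z [/interior_band zi /interior_band zj]].
  suff -> : i = j by [].
  have : h i < h j.+1 by lra.
  have : h j < h i.+1 by lra.
  by rewrite !h_lt; lia.
- by apply: finite_image; apply: (sub_finite_set _ (finite_II (m + k.+1)%N)) => i /=; lia.
- exact: bigcup_layers.
Qed.

(** Cut off the lowest layer along its upper base, then induct. *)
Lemma trivial_tiling_layers m k :
  trivial_tiling (band (h m) (h (m + k.+1)%N)) (layers m (m + k.+1)%N).
Proof.
elim: k m => [|k IHk] m.
  by rewrite addn1 layers1; exact: trivial_self.
set y := h m.+1.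
have my : h m < y by exact: h_incr.
have yk : y < h (m + k.+2)%N by rewrite h_lt; lia.
apply: (@trivial_cut _ _ _ (pt y y) (pt (W - y) y) (band (h m) y)
  (band y (h (m + k.+2)%N))).
- exact: tiling_layers.
- apply/eqP => /(frame_point_inj en)[]; have := h_small m.+1; rewrite -/y; lra.
- move=> z /(segment_level _ (h_small m.+1))[x [-> xy]].
  exists (band (h m) y); first by exists m => //=; lia.
  by apply: boundary_band_top => //; exact: ltW.
- exact: divides_band.
- by rewrite layers_sub; [rewrite layers1; exact: trivial_self|lia|lia].
- rewrite layers_sub; [|lia|lia].
  by have := IHk m.+1; rewrite addSnnS.
Qed.

End Stack.
End Bands.

(** * Trapezoids in coordinates *)

Section FrameCoordinates.
Context {R : realType}.
Local Notation plane := (R * R)%type.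
Variables (o e n : plane).
Hypothesis en : orthonormal e n.
Local Notation pt := (frame_point o e n).
Implicit Types (x y : R).

Lemma frame_pointB x y x' y' : pt x y - pt x' y' = frame_point 0 e n (x - x') (y - y').
Proof. by apply: planeE; rewrite /frame_point /= /GRing.scale /=; ring. Qed.

Lemma dot_coord x y x' y' :
  dot (frame_point 0 e n x y) (frame_point 0 e n x' y') = x * x' + y * y'.
Proof.
case: en => ee nn en0.
transitivity (x * x' * dot e e + (x * y' + y * x') * dot e n + y * y' * dot n n).
  by rewrite /dot /frame_point /= /GRing.scale /=; ring.
by rewrite ee nn en0; ring.
Qed.

Lemma parallel_coord x y x' y' :
  parallel (frame_point 0 e n x y) (frame_point 0 e n x' y') =
  (x * y' = y * x').
Proof.
have [s [s1 nE]] := orthonormal_rot en; case: en => ee _ _.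
have s0 : s != 0 by apply/eqP => s0; move: s1; rewrite s0; lra.
have E : (frame_point 0 e n x y).1 * (frame_point 0 e n x' y').2 -
   (frame_point 0 e n x y).2 * (frame_point 0 e n x' y').1 = s * (x * y' - y * x').
  transitivity (s * (x * y' - y * x') * dot e e); last by rewrite ee mulr1.
  by rewrite nE /dot /frame_point /= /GRing.scale /=; ring.
apply/propext; rewrite /parallel; split=> /eqP.
- by rewrite -subr_eq0 E mulf_eq0 (negbTE s0) subr_eq0 => /eqP.
- by move=> H; apply/eqP; rewrite -subr_eq0 E mulf_eq0 subr_eq0 H orbT.
Qed.

Lemma elength_coord x y : elength (frame_point 0 e n x y) = Num.sqrt (x ^+ 2 + y ^+ 2).
Proof. by rewrite /elength dot_coord -!expr2. Qed.

Lemma cos_pi4 : 0 < cos (pi / 4 : R) /\ cos (pi / 4 : R) ^+ 2 = 2^-1.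
Proof.
have pi0 := pi_gt0 R; split; first by apply: cos_gt0_pihalf; lra.
have := cos_mulr2n (pi / 4 : R).
have -> : (pi / 4) *+ 2 = pi / 2 :> R by rewrite -mulr_natr; field.
by rewrite cos_pihalf -mulr_natr; lra.
Qed.

(** An angle is 45 degrees when its cosine is positive and equal to the
    absolute value of its sine; the sine comes from Lagrange's identity. *)
Lemma angle_pi4 x1 y1 x2 y2 x3 y3 :
  let X := (x1 - x2) * (x3 - x2) + (y1 - y2) * (y3 - y2) in
  let Y := (x1 - x2) * (y3 - y2) - (y1 - y2) * (x3 - x2) in
  (angle (pt x1 y1) (pt x2 y2) (pt x3 y3) = pi / 4) = (0 < X /\ X ^+ 2 = Y ^+ 2).
Proof.
move=> X Y; apply/propext; rewrite /angle !frame_pointB !elength_coord dot_coord -/X.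
set N1 := (x1 - x2) ^+ 2 + _; set N2 := (x3 - x2) ^+ 2 + _.
have N1_ge0 : 0 <= N1 by rewrite addr_ge0 ?sqr_ge0.
have N2_ge0 : 0 <= N2 by rewrite addr_ge0 ?sqr_ge0.
have lagrange : X ^+ 2 + Y ^+ 2 = N1 * N2 by rewrite /X /Y /N1 /N2; ring.
rewrite -sqrtrM //; set S := Num.sqrt (N1 * N2).
have S2 : S ^+ 2 = X ^+ 2 + Y ^+ 2 by rewrite lagrange sqr_sqrtr ?mulr_ge0.
have S_ge0 : 0 <= S by exact: sqrtr_ge0.
have [c0 c2] := cos_pi4; have pi0 := pi_gt0 R.
have cK : acos (cos (pi / 4 : R)) = pi / 4 by rewrite cosK// in_itv/=; lra.
have [S0|S_neq0] := eqVneq S 0.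
  rewrite S0 invr0 mulr0 acos0; split; first lra.
  by move=> [X0 XY]; move: S2; rewrite S0 -XY; nra.
have S_gt0 : 0 < S by rewrite lt_neqAle eq_sym S_neq0.
have XS : -1 <= X / S <= 1.
  rewrite ler_pdivlMr// ler_pdivrMr// mulN1r mul1r.
  have Y2 := sqr_ge0 Y; apply/andP; split; nra.
split=> [H|[X0 XY]].
- have XE : X = cos (pi / 4) * S.
    by rewrite -H acosK ?in_itv//= divfK.
  split; first by rewrite XE mulr_gt0.
  have X2 : X ^+ 2 = S ^+ 2 / 2 by rewrite XE exprMn c2 mulrC.
  by move: S2; rewrite X2; lra.
- rewrite -cK; congr acos; apply/eqP.
  rewrite -(@eqrXn2 _ 2)//; [|by rewrite ltW ?divr_gt0|by rewrite ltW].
  rewrite c2 expr_div_n S2 -XY.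
  have X2 : 0 < X ^+ 2 by rewrite exprn_gt0.
  by apply/eqP; field; rewrite !gt_eqF//; lra.
Qed.

Lemma hull4_band W : 2 < W ->
  hull4 (pt 0 0) (pt W 0) (pt (W - 1) 1) (pt 1 1) = band o e n W 0 1.
Proof.
move=> W2; apply/seteqP; split=> z.
  move=> [a [b [c [f [[a0 b0 c0 f0] abcf ->]]]]]; apply/(bandP _ _ en).
  exists (b * W + c * (W - 1) + f), (c + f); split; last 2 first.
  - lra.
  - by apply/andP; split; nra.
  have -> : a = 1 - b - c - f by lra.
  by apply: planeE; rewrite /frame_point /= /GRing.scale /=; ring.
move=> /(bandP _ _ en)[x [y [-> y01 yx]]].
have D0 : 0 < W - y *+ 2 by lra.
(* At height y the section runs from one leg to the other, and t is the
   proportion in which x divides it. *)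
pose t := (x - y) / (W - y *+ 2).
have t01 : 0 <= t <= 1.
  by rewrite /t divr_ge0/= ?ler_pdivrMr//; lra.
have xE : x = y + t * (W - y *+ 2) by rewrite /t divfK ?gt_eqF//; ring.
exists ((1 - y) * (1 - t)), ((1 - y) * t), (y * t), (y * (1 - t)); split.
- by split; apply: mulr_ge0; lra.
- ring.
- by rewrite xE; apply: planeE; rewrite /frame_point /= /GRing.scale /=; ring.
Qed.

(** The model trapezoid: the legs rise at 45 degrees, so at height 1 each side
    has lost a length 1 of the base [m + 1]. *)
Lemma trapezoid45_pt m : 1 < m -> trapezoid45 m (band o e n (m + 1) 0 1)
  (pt 0 0) (pt (m + 1) 0) (pt m 1) (pt 1 1).
Proof.
move=> m1; rewrite /trapezoid45 /trapezoid /convex_quadrilateral /collinear.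
rewrite !frame_pointB !parallel_coord !elength_coord !angle_pi4.
have -> : Num.sqrt ((1 - m) ^+ 2 + (1 - 1) ^+ 2) = m - 1.
  by rewrite subrr expr0n addr0 -sqrrN sqrtr_sqr gtr0_norm; lra.
have -> : Num.sqrt ((m + 1 - 0) ^+ 2 + (0 - 0) ^+ 2) = m + 1.
  by rewrite !subr0 expr0n addr0 sqrtr_sqr gtr0_norm; lra.
split; [split; [split|..]|..].
- by split; nra.
- (* The legs extended meet at the apex, so the diagonals cross on the axis
     of symmetry, at height (m + 1) / (2 m). *)
  pose t := (m + 1) / (m *+ 2).
  have tE : t * (m *+ 2) = m + 1 by rewrite /t divfK// gt_eqF//; lra.
  have t01 : 0 <= t <= 1 by apply/andP; split; nra.
  have m2 : m * t *+ 2 = m + 1 by rewrite -tE; ring.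
  exists ((1 - t) *: pt 0 0 + t *: pt m 1); split; exists t; split=> //.
  apply: planeE; rewrite /frame_point /= /GRing.scale /=; apply: subr0_eq.
    transitivity ((m * t *+ 2 - (m + 1)) * e.1); first ring.
    by rewrite m2 subrr mul0r.
  transitivity ((m * t *+ 2 - (m + 1)) * e.2); first ring.
  by rewrite m2 subrr mul0r.
- by rewrite -(hull4_band (W := m + 1)) ?addrK//; lra.
- ring.
- nra.
- lra.
- exists (pt m 0); split.
  + exists (m / (m + 1)).
    by apply: planeE; rewrite /frame_point /= /GRing.scale /=; field; lra.
  + by rewrite !frame_pointB dot_coord; ring.
  + by rewrite frame_pointB elength_coord subrr expr0n add0r sqrtr_sqr subr0 normr1.
- by split; split; nra.
- by field.
Qed.

End FrameCoordinates.

Section Trapezoids.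
Context {R : realType}.
Local Notation plane := (R * R)%type.
Implicit Types (o e n p q r s : plane) (F A : set plane) (m W u v : R).

Lemma frame_point0 o e n : frame_point o e n 0 0 = o.
Proof. by rewrite /frame_point !scale0r !addr0. Qed.

(** In the frame with first axis along the larger base, of length [L], the two
    angles and the height put [s] at [(1, y)] and [r] at [(L - 1, y)] with
    [y = 1] or [y = -1]; the second axis is then turned towards the trapezoid.
    The smaller base has length [`|L - 2|], and [1 < m] excludes [L < 2], for
    which the half sum of the bases would be 1. *)
Lemma trapezoid45_band m F p q r s : 1 < m -> trapezoid45 m F p q r s ->
  exists e n, [/\ orthonormal e n, q - p = (m + 1) *: e
                & F = band p e n (m + 1) 0 1].
Proof.
move=> m1 [[[_ _ FE] par _] lt_bases dist [angp angq] mid].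
set L := elength (q - p) in lt_bases mid.
have L_gt0 : 0 < L by apply: le_lt_trans lt_bases; exact: sqrtr_ge0.
pose e := L^-1 *: (q - p); pose n0 : plane := (- e.2, e.1).
have qpE : q - p = L *: e by rewrite /e scalerA divff ?scale1r// gt_eqF.
have ee : dot e e = 1.
  have L2 : L ^+ 2 = dot (q - p) (q - p).
    by rewrite sqr_sqrtr// /dot addr_ge0// -expr2 sqr_ge0.
  transitivity (L^-1 ^+ 2 * dot (q - p) (q - p)).
    by rewrite /e /dot /= /GRing.scale /=; ring.
  by rewrite -L2 -exprMn mulVf ?expr1n// gt_eqF.
have en0 : orthonormal e n0.
  split=> //; last by rewrite /dot /=; ring.
  by rewrite -ee /dot /=; ring.
pose pt := frame_point p e n0.
have pE : p = pt 0 0 by rewrite /pt frame_point0.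
have qE : q = pt L 0 by rewrite /pt /frame_point scale0r addr0 -qpE addrC subrK.
have [x [y rE]] : exists x y, r = pt x y.
  by exists (dot (r - p) e), (dot (r - p) n0); exact: frame_pointE.
have [x' [y' sE]] : exists x' y', s = pt x' y'.
  by exists (dot (s - p) e), (dot (s - p) n0); exact: frame_pointE.
have yy' : y = y'.
  move: par; rewrite pE qE rE sE !frame_pointB parallel_coord// => /eqP.
  rewrite subr0 subrr mul0r mulf_eq0 gt_eqF//= subr_eq0 => /eqP ->.
  by [].
have y2 : y ^+ 2 = 1.
  have [f [[t fE] orth fr]] := dist.
  have {}fE : f = pt (t * L) 0.
    rewrite fE pE qE /pt; apply: planeE;
      by rewrite /frame_point /= /GRing.scale /=; ring.
  have qpE0 : q - p = frame_point 0 e n0 L 0.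
    by rewrite qpE /frame_point scale0r addr0 add0r.
  move: orth fr; rewrite fE rE qpE0 !frame_pointB dot_coord//.
  rewrite elength_coord// !subr0 mulr0 addr0 => /eqP.
  rewrite mulf_eq0 (gt_eqF L_gt0) orbF => /eqP ->.
  rewrite expr0n add0r => y1.
  by rewrite -(sqr_sqrtr (sqr_ge0 y)) y1 expr1n.
have L2_neq0 : L ^+ 2 != 0 by rewrite expf_neq0// gt_eqF.
have x'1 : x' = 1.
  move: angp; rewrite sE pE qE angle_pi4// => -[].
  rewrite !subr0 !mulr0 addr0 sub0r pmulr_lgt0// => x'0.
  by rewrite sqrrN !exprMn => /(mulIf L2_neq0); rewrite -yy' y2; nra.
have x1 : x = L - 1.
  move: angq; rewrite rE pE qE angle_pi4// => -[].
  rewrite !subr0 !sub0r !mul0r subr0 addr0 mulNr -mulrN pmulr_rgt0// => xL.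
  by rewrite exprMn [RHS]exprMn [(- L) ^+ 2]sqrrN => /(mulfI L2_neq0); rewrite y2; nra.
have LE : L = m + 1.
  move: mid; rewrite rE sE frame_pointB elength_coord// yy' subrr expr0n addr0.
  rewrite sqrtr_sqr x1 x'1; case: (ler0P (1 - (L - 1))); lra.
exists e, (y *: n0).
have en : orthonormal e (y *: n0).
  case: en0 => _ nn en; split=> //.
  - by rewrite dotZ nn -expr2 y2 mulr1.
  - by rewrite -[e in dot e _]scale1r dotZ en mulr0.
split=> //; first by rewrite -LE.
rewrite FE -(hull4_band p en); last lra.
by congr (hull4 _ _ _ _);
  rewrite ?frame_point0// 1?qE 1?rE 1?sE -?yy' -?LE ?x1 ?x'1 /pt /frame_point
    ?scale0r// ?scale1r.
Qed.

(** Reflection in the axis of symmetry. *)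
Lemma band_sym o e n W u v : orthonormal e n ->
  band o e n W u v = band (o + W *: e) (- e) n W u v.
Proof.
move=> [ee _ en].
have E1 z : dot (z - (o + W *: e)) (- e) = W - dot (z - o) e.
  transitivity (W * dot e e - dot (z - o) e); last by rewrite ee mulr1.
  by rewrite /dot /= /GRing.scale /=; ring.
have E2 z : dot (z - (o + W *: e)) n = dot (z - o) n.
  transitivity (dot (z - o) n - W * dot e n); last by rewrite en mulr0 subr0.
  by rewrite /dot /= /GRing.scale /=; ring.
by apply/seteqP; split=> z; rewrite /band /= E1 E2 => -[? ?]; split=> //; lra.
Qed.

(** Frames with parallel first axes agree up to the signs of the two axes, and
    the symmetry of the trapezoid makes the two signs equal. *)
Lemma band_parallel_frame e n o' e' n' W :
  orthonormal e n -> orthonormal e' n' -> parallel e' e ->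
  exists o eps, eps ^+ 2 = 1 /\
    forall u v, band o' e' n' W u v = band o (eps *: e) (eps *: n) W u v.
Proof.
move=> en en' par.
have coord z : exists x y, z = frame_point 0 e n x y.
  by exists (dot (z - 0) e), (dot (z - 0) n); exact: frame_pointE.
have [x [y e'E]] := coord e'; have [x' [y' n'E]] := coord n'.
have eE : frame_point 0 e n 1 0 = e.
  by rewrite /frame_point scale1r scale0r add0r addr0.
have y0 : y = 0.
  by move: par; rewrite e'E -[X in parallel _ X]eE parallel_coord//; lra.
case: (en'); rewrite e'E n'E !dot_coord// y0 !mulr0 !mul0r !addr0 => x2 xy2 xx'.
have x'0 : x' = 0.
  apply/eqP; move/eqP: xx'; rewrite mulf_eq0 => /orP[/eqP x0|//].
  by move: x2; rewrite x0; lra.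
move: xy2; rewrite x'0 mulr0 add0r => y2.
have -> : frame_point 0 e n x 0 = x *: e by rewrite /frame_point scale0r add0r addr0.
have -> : frame_point 0 e n 0 y' = y' *: n by rewrite /frame_point scale0r !add0r.
have [xy|xy] : x = y' \/ - x = y'.
  have /eqP : (x - y') * (x + y') = 0 by rewrite -[RHS](subrr (1 : R)) -{1}x2 -y2; ring.
  by rewrite mulf_eq0 => /orP[] /eqP ?; [left|right]; lra.
- by exists o', y'; rewrite xy expr2.
- exists (o' + W *: (x *: e)), y'; split; first by rewrite expr2.
  move=> u v; rewrite band_sym; first by rewrite -xy !scaleNr.
  case: en => ee nn en0; split.
  + by rewrite dotZ x2 ee mulr1.
  + by rewrite dotZ y2 nn mulr1.
  + by rewrite dotZ en0 mulr0.
Qed.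

Lemma orthonormal_scale (eps : R) e n :
  eps ^+ 2 = 1 -> orthonormal e n -> orthonormal (eps *: e) (eps *: n).
Proof. by move=> eps2 [ee nn en]; split; rewrite dotZ -expr2 eps2 mul1r.
Qed.

(** The angles agree, so the band has the shape of the trapezoid of height 1 on
    the base [L] once the ratio of its lower base to its height is [L].  When
    [eps] is -1 the band is turned by half a turn, and the factor of the
    homothety is negative. *)
Lemma homothetic_band p o e n (eps L W u v : R) :
  orthonormal e n -> eps ^+ 2 = 1 -> u < v -> W - u *+ 2 = (v - u) * L ->
  homothetic (band p e n L 0 1) (band o (eps *: e) (eps *: n) W u v).
Proof.
move=> en eps2 uv WL; have een := orthonormal_scale eps2 en.
have vu0 : 0 < v - u by lra.
pose l := eps * (v - u).
pose w := frame_point o (eps *: e) (eps *: n) u u - l *: p.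
have H x y : l *: frame_point p e n x y + w =
    frame_point o (eps *: e) (eps *: n) (u + (v - u) * x) (u + (v - u) * y).
  by rewrite /w /l /frame_point; apply: planeE; rewrite /= /GRing.scale /=; ring.
exists l, w; split.
  rewrite mulf_neq0 ?(gt_eqF vu0)//.
  by apply/eqP => e0; move: eps2; rewrite e0; lra.
apply/seteqP; split=> z.
- move=> /(bandP _ _ een)[x [y [-> uyv yxW]]].
  exists (frame_point p e n ((x - u) / (v - u)) ((y - u) / (v - u))); last first.
    rewrite H; congr frame_point; rewrite mulrC divfK ?gt_eqF//; ring.
  apply/(band_pt _ _ en); rewrite ler_pM2r ?invr_gt0// divr_ge0/=; [|lra..].
  rewrite ler_pdivrMr// mul1r ler_pdivrMr// mulrBl divfK ?gt_eqF//.
  by split; nra.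
- move=> [_ /(bandP _ _ en)[x [y [-> y01 yxL]]] <-].
  by rewrite H; apply/(band_pt _ _ een); split; apply/andP; split; nra.
Qed.

(** * The pile of homothetic trapezoids *)

(** The bases of the successive layers, counted from the lower base [W], have
    lengths [W * g ^+ i], where [g] is the ratio of the bases of the tile. *)
Lemma trivially_tiled_power m k p e n o' e' n' : 1 < m ->
  orthonormal e n -> orthonormal e' n' -> parallel e' e ->
  trivially_tiled_by_homothets
    (band o' e' n' (midline_of_ratio (G m ^+ k.+1) + 1) 0 1)
    (band p e n (m + 1) 0 1).
Proof.
move=> m1 en en' par.
set g := G m; set W := midline_of_ratio _ + 1.
have /andP[g0 g1] : 0 < g < 1 by exact: G_gt0_lt1.
have /andP[gk0 gk1] : 0 < g ^+ k.+1 < 1 by apply: exprn_gt0_lt1; rewrite g0.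
have WE : W * (1 - g ^+ k.+1) = 2.
  by rewrite /W /midline_of_ratio mulrDl divfK ?subr_eq0 ?gt_eqF//; ring.
have W0 : 0 < W by have := midline_gt1 (introT andP (conj gk0 gk1)); rewrite /W; lra.
have gLE : (1 - g) * (m + 1) = 2 by rewrite /g /G mulrBl divfK ?gt_eqF//; lra.
pose h i := W * (1 - g ^+ i) / 2.
have Wg i : 0 < W * g ^+ i by rewrite mulr_gt0// exprn_gt0.
have hS i : h i.+1 - h i = W * g ^+ i * (1 - g) / 2 by rewrite /h exprS; ring.
have h_incr i : h i < h i.+1.
  by rewrite -subr_gt0 hS divr_gt0// mulr_gt0// subr_gt0.
have h_small i : h i < W / 2 by have := Wg i; rewrite /h; lra.
have h0 : h 0%N = 0 by rewrite /h expr0 subrr mulr0 mul0r.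
have hk : h k.+1 = 1 by rewrite /h WE divff.
have [c [eps [eps2 bandE]]] := band_parallel_frame o' W en en' par.
have een := orthonormal_scale eps2 en.
have := tiling_layers c W een h_incr 0 k.
have := trivial_tiling_layers c een h_incr h_small 0 k.
rewrite add0n h0 hk -bandE => triv til.
eexists; split; [exact: til|exact: triv|move=> _ [i _ <-]].
apply: homothetic_band => //.
transitivity (W * g ^+ i * ((1 - g) * (m + 1)) / 2); first by rewrite gLE /h; field.
by rewrite hS; field.
Qed.

End Trapezoids.

Theorem mainTheorem4 (R : realType) (d : rat) (hd : 0 < d)
    (hirr : irrational (Num.sqrt (ratr d) : R))
    (a : R) (ha : Qsqrt d a) (hconj : 1 < conjQ d a) (hlt : conjQ d a < a)
    (A : set (R * R)) (p q r s : R * R) (hA : trapezoid45 a A p q r s) :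
  infinite_set [set b : R |
    [/\ Qsqrt d b,
        ln (G b) / ln (conjQ d (G b)) = ln (G a) / ln (conjQ d (G a)),
        exists B p' q' r' s',
          trapezoid45 b B p' q' r' s' /\ parallel (q' - p') (q - p)
      & forall B p' q' r' s',
          trapezoid45 b B p' q' r' s' -> parallel (q' - p') (q - p) ->
          trivially_tiled_by_homothets B A]].
Proof.
have a1 : 1 < a by lra.
have [e [n [en qpE AE]]] := trapezoid45_band a1 hA.
have g01 : 0 < G a < 1 := G_gt0_lt1 a1.
have g'01 : 0 < G (conjQ d a) < 1 := G_gt0_lt1 hconj.
have gg' : conjugates d (G a) (G (conjQ d a)).
  by apply: conjugates_G => //; [rewrite gt_eqF//; lra..|exact: conjugates_conjQ].
pose b k := midline_of_ratio (G a ^+ k.+1).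
have gk01 k : 0 < G a ^+ k.+1 < 1 by exact: exprn_gt0_lt1.
have Gb k : G (b k) = G a ^+ k.+1.
  by rewrite G_midline//; have := gk01 k; case: eqP => // ->; rewrite ltxx andbF.
have b1 k : 1 < b k by exact: midline_gt1.
have b_inj : injective b.
  move=> i j /(congr1 G); rewrite !Gb => E; apply: succn_inj; apply/eqP.
  case/andP: g01 => g0 g1.
  by move/eqP: E; rewrite !eq_le !ler_iXn2l// andbC.
apply: (@sub_infinite_set _ (range b)); last first.
  apply/infiniteP; have := inj_card_eq (in2W b_inj : {in [set: nat] &, injective b}).
  by rewrite card_eq_le => /andP[].
move=> _ [k _ <-]; split.
- have c1 : conjugates d (1 : R) 1 by rewrite -(rmorph1 (@ratr R)); exact: conjugates_rat.
  have /andP[gk0 gk1] := gk01 k.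
  have /andP[g'k0 g'k1] : 0 < G (conjQ d a) ^+ k.+1 < 1 by exact: exprn_gt0_lt1.
  have cX := conjugatesX hd k.+1 gg'.
  apply: (conjugates_Qsqrt (y := midline_of_ratio (G (conjQ d a) ^+ k.+1))).
  apply: conjugatesM => //; first exact: conjugatesD c1 cX.
  apply: (conjugatesV hd); last exact: conjugatesD c1 (conjugatesN cX).
  + by rewrite gt_eqF// subr_gt0.
  + by rewrite gt_eqF// subr_gt0.
- rewrite Gb (conjQE hirr (conjugatesX hd k.+1 gg')) (conjQE hirr gg').
  case/andP: g01 => g0 g1; case/andP: g'01 => g'0 g'1.
  by rewrite (lnXn k.+1 g0) (lnXn k.+1 g'0) divr_mulrn.
- exists (band 0 e n (b k + 1) 0 1), 0, ((b k + 1) *: e),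
    (frame_point 0 e n (b k) 1), (frame_point 0 e n 1 1).
  have := trapezoid45_pt 0 en (b1 k).
  rewrite frame_point0 {1}/frame_point scale0r add0r addr0.
  split=> //; rewrite qpE /parallel /= /GRing.scale /=; ring.
- move=> B p' q' r' s' hB par.
  have [e' [n' [en' qpE' BE]]] := trapezoid45_band (b1 k) hB.
  rewrite AE BE; apply: trivially_tiled_power => //.
  have c0 : (b k + 1) * (a + 1) != 0.
    by rewrite mulf_neq0// gt_eqF//; [have := b1 k|]; lra.
  apply: (mulfI c0); move: par; rewrite qpE qpE' /parallel /= /GRing.scale /= => par.
  by transitivity ((b k + 1) * e'.1 * ((a + 1) * e.2)); [ring|rewrite par; ring].
Qed.
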